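(* Let $k$ be an algebraically closed field, $n\ge 1$, and let $L\in\mathcal{P}(k^n)$ be a polynomial operator curve such that $\Sigma(L)\neq k$. Then, for every $\lambda_0\in\Sigma(L)$, $$\mathfrak{m}[L,\lambda_0]=i(\pi^{-1}(\mathcal{S}(k^n)),\mathcal{R}(L);c_{\lambda_0}),\qquad c_{\lambda_0}:=(L(\lambda_0),\lambda_0).$$
   Context: $\mathcal{L}(k^n)$ is the space of linear maps $k^n\to k^n$, identified with $n\times n$ matrices and with affine space $\operatorname{Spec}k[x_1,\dots,x_{n^2}]$ (the $x_i$ being the matrix entries). $\mathcal{S}(k^n)$ is the subscheme of non-invertible maps, $\operatorname{Spec}(k[x_1,\dots,x_{n^2}]/\mathfrak{D})$ with $\mathfrak{D}=\langle\det(x_1,\dots,x_{n^2})\rangle$. $\mathcal{P}(k^n)$ is the set of polynomial operator curves $L(\lambda)=\sum_{i=0}^m T_i\lambda^i$ with $T_i\in\mathcal{L}(k^n)$, $T_m\ne 0$. Write $L(\lambda)=(L_i(\lambda))_{1\le i\le n^2}$ for its entries, $L_i\in k[\lambda]$. The spectrum is $\Sigma(L)=\{\lambda\in k:\det(L(\lambda))=0\}$, and for $\lambda_0\in\Sigma(L)$ the algebraic multiplicity is $\mathfrak{m}[L,\lambda_0]=\operatorname{ord}_{\lambda=\lambda_0}\det(L(\lambda))$. The resolution of $L$ is the scheme $$\mathcal{R}(L)=\operatorname{Spec}\left(\frac{k[\lambda,x_1,\dots,x_{n^2}]}{\mathfrak{P}_L}\right),\qquad \mathfrak{P}_L=\langle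 x_1-L_1(\lambda),\dots,x_{n^2}-L_{n^2}(\lambda)\rangle.$$ $\pi:\operatorname{Spec}k[\lambda,x_1,\dots,x_{n^2}]\to\operatorname{Spec}k[x_1,\dots,x_{n^2}]$ is the projection forgetting $\lambda$, so $\pi^{-1}(\mathcal{S}(k^n))$ is the closed subscheme of $\operatorname{Spec}k[\lambda,x_1,\dots,x_{n^2}]$ defined by the ideal $\langle\det(x_1,\dots,x_{n^2})\rangle$. A point $(T,\lambda)$ has matrix coordinates $T$ and parameter coordinate $\lambda$. Intersection multiplicity (Serre): for subvarieties $X_1,X_2$ of a smooth variety $X$ intersecting properly, and $c$ an isolated point of $X_1\cap X_2$, with ideals $\mathfrak{P}_{X_1},\mathfrak{P}_{X_2}$ in the local ring $\mathcal{O}_{c,X}$, $$i(X_1,X_2;c)=\sum_{i=0}^{\dim X}(-1)^i\,\ell_{\mathcal{O}_{c,X}}\operatorname{Tor}_i^{\mathcal{O}_{c,X}}(\mathcal{O}_{c,X}/\mathfrak{P}_{X_1},\mathcal{O}_{c,X}/\mathfrak{P}_{X_2}),$$ where $\ell$ is module length. When $X_1,X_2$ are Cohen--Macaulay this equals $\ell_{\mathcal{O}_{c,X}}(\mathcal{O}_{c,X}/(\mathfrak{P}_{X_1}+\mathfrak{P}_{X_2}))$. Here $X=\operatorname{Spec}k[\lambda,x_1,\dots,x_{n^2}]$. *)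

(* Defs.v *)
From HB Require Import structures.
From mathcomp Require Import all_boot all_algebra generic_quotient ring_quotient.
From mathcomp Require Import boolp classical_sets.
From mathcomp Require Import freeg mpoly.

Set Implicit Arguments.
Unset Strict Implicit.
Unset Printing Implicit Defensive.

Import GRing.Theory.
Local Open Scope ring_scope.
Local Open Scope quotient_scope.
Local Open Scope classical_set_scope.

Section Modules.
Variable R : comNzRingType.
Implicit Types U V W : lmodType R.

Definition submodule V (A : set V) : Prop :=
  A 0 /\ forall a u v, A u -> A v -> A (a *: u + v).

(* For V = R^o this is the ideal generated by A *)
Definition span V (A : set V) : set V :=
  [set v | forall B : set V, submodule B -> A `<=` B -> B v].

Lemma span_submodule V (A : set V) : submodule (span A).
Proof.
split=> [B [] //|a u v Au Av B sB AB]; case: (sB) => _; apply; first exact: Au.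
exact: Av.
Qed.

Definition in_span V (A : set V) : {pred V} := fun v => `[< span A v >].

Lemma in_spanP V (A : set V) v : reflect (span A v) (v \in in_span A).
Proof. exact: asboolP. Qed.

Lemma in_span_submod_closed V (A : set V) : submod_closed (in_span A).
Proof.
have [s0 sD] := span_submodule A; split=> [|a u v /in_spanP Au /in_spanP Av].
  by apply/in_spanP; exact: s0.
by apply/in_spanP; exact: sD.
Qed.

HB.instance Definition _ V (A : set V) :=
  GRing.isSubmodClosed.Build R V (in_span A) (in_span_submod_closed A).

(* V / <A> *)
Definition quotmod V (A : set V) : Type := Quotient.quot (in_span A).

Section QuotMod.
Variables (V : lmodType R) (A : set V).

HB.instance Definition _ := Choice.on (quotmod A).
HB.instance Definition _ := GRing.Zmodule.on (quotmod A).

Definition quotpi (v : V) : quotmod A := \pi_(Quotient.quot (in_span A)) v.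
Definition quotrepr (q : quotmod A) : V := repr (q : (Quotient.quot (in_span A))).

Lemma quotreprK : cancel quotrepr quotpi.
Proof. exact: reprK. Qed.

Lemma quotpi_eq u v : quotpi u = quotpi v <-> span A (u - v).
Proof.
split=> [/eqP|Auv]; first by rewrite -Quotient.idealrBE => /in_spanP.
by apply/eqP; rewrite -Quotient.idealrBE; apply/in_spanP.
Qed.

Lemma quotpiD : {morph quotpi : u v / u + v}.
Proof. by move=> u v; rewrite /quotpi raddfD. Qed.

Definition quotscale a (q : quotmod A) : quotmod A := quotpi (a *: quotrepr q).

Lemma quotpi_scale a v : quotpi (a *: v) = quotscale a (quotpi v).
Proof.
apply/quotpi_eq; rewrite -scalerBr -[_ *: _]addr0.
have [s0 sD] := span_submodule A; apply: sD => //.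
by apply/quotpi_eq; rewrite quotreprK.
Qed.

Let scaleA a b q : quotscale a (quotscale b q) = quotscale (a * b) q.
Proof. by rewrite -[q]quotreprK -!quotpi_scale scalerA. Qed.
Let scale1 : left_id 1 quotscale.
Proof. by move=> q; rewrite -[q]quotreprK -quotpi_scale scale1r. Qed.
Let scaleDr : right_distributive quotscale +%R.
Proof.
move=> a p q; rewrite -[p]quotreprK -[q]quotreprK -quotpiD.
by rewrite -!quotpi_scale scalerDr quotpiD.
Qed.
Let scaleDl q : {morph quotscale^~ q : a b / a + b}.
Proof.
by move=> a b; rewrite -[q]quotreprK -!quotpi_scale scalerDl quotpiD.
Qed.

HB.instance Definition _ :=
  GRing.Zmodule_isLmodule.Build R (quotmod A) scaleA scale1 scaleDr scaleDl.

Lemma quotpi_is_linear : linear quotpi.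
Proof. by move=> a u v; rewrite quotpiD quotpi_scale. Qed.

HB.instance Definition _ :=
  GRing.isLinear.Build R V (quotmod A) *:%R quotpi quotpi_is_linear.

End QuotMod.

Definition in_kernel U V (f : {linear U -> V}) : {pred U} := fun u => f u == 0.

Lemma in_kernel_submod_closed U V (f : {linear U -> V}) :
  submod_closed (in_kernel f).
Proof.
split=> [|a u v /eqP fu /eqP fv]; first by rewrite unfold_in /in_kernel linear0.
by rewrite unfold_in /in_kernel linearP fu fv scaler0 addr0.
Qed.

HB.instance Definition _ U V (f : {linear U -> V}) :=
  GRing.isSubmodClosed.Build R U (in_kernel f) (in_kernel_submod_closed f).

Definition kernel U V (f : {linear U -> V}) : Type := {u : U | u \in in_kernel f}.

HB.instance Definition _ U V (f : {linear U -> V}) := SubChoice.on (kernel f).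
HB.instance Definition _ U V (f : {linear U -> V}) :=
  [SubChoice_isSubLmodule of kernel f by <:].

(* ker g / (im f `&` ker g), for f and g two successive maps of a complex *)
Definition homology U V W (f : {linear U -> V}) (g : {linear V -> W}) :
    lmodType R :=
  quotmod [set z : kernel g | exists u, f u = val z].

Definition has_chain V (l : nat) : Prop :=
  exists B : nat -> set V,
    (forall i, (i <= l)%N -> submodule (B i)) /\
    (forall i, (i < l)%N -> B i `<` B i.+1).

Definition is_length V (l : nat) : Prop :=
  has_chain V l /\ forall l', has_chain V l' -> (l' <= l)%N.

(* None stands for infinite length *)
Definition module_length V : option nat :=
  match pselect (exists l, is_length V l) with
  | left len => Some (sval (cid len))
  | right _ => None
  end.

Lemma fglift_is_linear (K : choiceType) V (f : K -> V) :
  linear (fglift f : {freeg K / R} -> V).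
Proof.
have addf : additive (fglift f) := lift_is_additive f.
have fg0 : fglift f 0 = 0 by rewrite -[0 in LHS](subrr 0) addf subrr.
have fgN : {morph fglift f : x / - x}.
  by move=> x; rewrite -[- x]add0r addf fg0 add0r.
have fgD : {morph fglift f : x y / x + y}.
  by move=> x y; rewrite -[y]opprK addf fgN !opprK.
have fgsum (I : Type) (r : seq I) (F : I -> {freeg K / R}) :
    fglift f (\sum_(i <- r) F i) = \sum_(i <- r) fglift f (F i).
  exact: (big_morph _ fgD fg0).
move=> a x y; rewrite fgD; congr (_ + _).
rewrite -[x in RHS]freeg_sumE {1}/GRing.scale /= /fgscale !fgsum scaler_sumr.
by apply: eq_bigr => z _; rewrite !liftU scalerA.
Qed.

HB.instance Definition _ (K : choiceType) V (f : K -> V) :=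
  GRing.isLinear.Build R {freeg K / R} V *:%R (fglift f) (fglift_is_linear f).

Section Tensor.
Variables V W : lmodType R.

Definition pure_pair (v : V) (w : W) : {freeg (V * W)%type / R} := << (v, w) >>.

Inductive tensor_rel : set {freeg (V * W)%type / R} :=
| TensorDl v v' w :
    tensor_rel (pure_pair (v + v') w - (pure_pair v w + pure_pair v' w))
| TensorDr v w w' :
    tensor_rel (pure_pair v (w + w') - (pure_pair v w + pure_pair v w'))
| TensorZl a v w :
    tensor_rel (pure_pair (a *: v) w - a *: pure_pair v w)
| TensorZr a v w :
    tensor_rel (pure_pair v (a *: w) - a *: pure_pair v w).

Definition tensor : lmodType R := quotmod tensor_rel.

End Tensor.

Section TensorMap.
Variables (U V W : lmodType R) (f : {linear U -> V}).

Definition free_tensor_map : {freeg (U * W)%type / R} -> {freeg (V * W)%type / R} :=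
  fglift (fun p => pure_pair (f p.1) p.2).

HB.instance Definition _ := GRing.Linear.on free_tensor_map.

(* f (x) id_W *)
Definition tensor_map (t : tensor U W) : tensor V W :=
  quotpi _ (free_tensor_map (quotrepr t)).

Lemma free_tensor_map_pure u w :
  free_tensor_map (pure_pair u w) = pure_pair (f u) w.
Proof. by rewrite /free_tensor_map liftU scale1r. Qed.

Lemma free_tensor_map_span x :
  span (@tensor_rel U W) x -> span (@tensor_rel V W) (free_tensor_map x).
Proof.
have [s0 sD] := span_submodule (@tensor_rel V W).
move/(_ (fun y => span (@tensor_rel V W) (free_tensor_map y))); apply.
  by split=> [|a u v uS vS]; rewrite ?linear0 // linearP; apply: sD.
move=> _ [v v' w|v w w'|a v w|a v w] B _; apply.
- rewrite linearB linearD /= !free_tensor_map_pure linearD; exact: TensorDl.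
- rewrite linearB linearD /= !free_tensor_map_pure; exact: TensorDr.
- rewrite linearB linearZ_LR /= !free_tensor_map_pure linearZ_LR; exact: TensorZl.
- rewrite linearB linearZ_LR /= !free_tensor_map_pure; exact: TensorZr.
Qed.

Lemma tensor_map_pi x :
  tensor_map (quotpi _ x) = quotpi _ (free_tensor_map x).
Proof.
apply/quotpi_eq; rewrite -linearB; apply: free_tensor_map_span.
by apply/quotpi_eq; rewrite quotreprK.
Qed.

Lemma tensor_map_is_linear : linear tensor_map.
Proof.
move=> a s t; rewrite -[s]quotreprK -[t]quotreprK -linearP !tensor_map_pi.
by rewrite !linearP.
Qed.

HB.instance Definition _ :=
  GRing.isLinear.Build R (tensor U W) (tensor V W) *:%R tensor_map
    tensor_map_is_linear.

End TensorMap.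

Arguments tensor_map {U V} W f t.

(* The canonical free resolution  ... -> F_1 -> F_0 -> M: F_i is free on the
   elements of the i-th syzygy module Z_i, where Z_0 = M and Z_(i+1) is the
   kernel of the augmentation F_i -> Z_i. *)
Definition augmentation V : {freeg V / R} -> V := fglift id.

HB.instance Definition _ V := GRing.Linear.on (@augmentation V).

Fixpoint syzygy (M : lmodType R) (i : nat) : lmodType R :=
  if i is j.+1 then kernel (@augmentation (syzygy M j)) else M.

Definition free_res (M : lmodType R) (i : nat) : lmodType R :=
  {freeg (syzygy M i) / R}.

Definition free_res_d (M : lmodType R) (i : nat) (x : free_res M i.+1) :
    free_res M i :=
  val (augmentation x : kernel (@augmentation (syzygy M i))).

Lemma free_res_d_is_linear M i : linear (@free_res_d M i).
Proof. by move=> a x y; rewrite /free_res_d !linearP. Qed.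

HB.instance Definition _ M i :=
  GRing.isLinear.Build R (free_res M i.+1) (free_res M i) *:%R (@free_res_d M i)
    (@free_res_d_is_linear M i).

Definition Tor (i : nat) (M N : lmodType R) : lmodType R :=
  if i is j.+1 then
    homology (tensor_map N (@free_res_d M j.+1)) (tensor_map N (@free_res_d M j))
  else quotmod (range (tensor_map N (@free_res_d M 0))).

End Modules.

Arguments tensor_map {R U V} W f t.

Definition ideal_gen (R : comNzRingType) (A : set R) : set R := span (A : set R^o).

Section LocalRing.
Variables (k : fieldType) (N : nat) (c : 'I_N -> k).

(* The local ring of affine N-space at the k-point c, inside its function
   field. *)
Definition regular_at : {pred {fraction {mpoly k[N]}}} := fun x =>
  `[< exists p q : {mpoly k[N]}, q.@[c] != 0 /\ x = tofrac p / tofrac q >].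

Lemma regular_at_subring_closed : subring_closed regular_at.
Proof.
have nz (q : {mpoly k[N]}) : q.@[c] != 0 -> tofrac q != 0.
  by rewrite tofrac_eq0; apply: contra_neq => ->; rewrite meval0.
split.
- apply/asboolP; exists 1, 1.
  by rewrite meval1 oner_neq0 rmorph1 divr1.
- move=> _ _ /asboolP [p [q [qc ->]]] /asboolP [r [s [sc ->]]].
  apply/asboolP; exists (p * s - r * q), (q * s).
  rewrite mevalM mulf_neq0 //; split=> //.
  by rewrite -mulNr addf_div ?nz // rmorphB !rmorphM mulNr.
- move=> _ _ /asboolP [p [q [qc ->]]] /asboolP [r [s [sc ->]]].
  apply/asboolP; exists (p * r), (q * s).
  by rewrite mevalM mulf_neq0 // mulf_div !rmorphM.
Qed.

HB.instance Definition _ :=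
  GRing.isSubringClosed.Build {fraction {mpoly k[N]}} regular_at
    regular_at_subring_closed.

Definition local_ring : Type := {x : {fraction {mpoly k[N]}} | x \in regular_at}.

HB.instance Definition _ := SubChoice.on local_ring.
HB.instance Definition _ := [SubChoice_isSubComNzRing of local_ring by <:].

Lemma tofrac_regular (p : {mpoly k[N]}) : tofrac p \in regular_at.
Proof.
by apply/asboolP; exists p, 1; rewrite meval1 oner_neq0 rmorph1 divr1.
Qed.

Definition to_local (p : {mpoly k[N]}) : local_ring :=
  exist _ (tofrac p) (tofrac_regular p).

(* The O_c-module O_c / (I O_c) *)
Definition local_quot (I : set {mpoly k[N]}) : lmodType local_ring :=
  quotmod (to_local @` I : set local_ring^o).

(* Serre's alternating sum for the closed subschemes of affine N-space with
   ideals I and J, at c; None if one of the lengths is infinite. *)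
Definition intersection_mult (I J : set {mpoly k[N]}) : option int :=
  let len i := module_length (Tor i (local_quot I) (local_quot J)) in
  if [forall i : 'I_N.+1, isSome (len i)] then
    Some (\sum_(i < N.+1) (-1) ^+ i * (odflt 0%N (len i))%:Z)
  else None.

End LocalRing.

Section OperatorCurves.
Variables (k : fieldType) (n : nat).

Record operator_curve := OperatorCurve {
  curve_deg : nat;
  curve_coef : 'I_curve_deg.+1 -> 'M[k]_n;
  curve_lead_neq0 : curve_coef ord_max != 0
}.

Variable L : operator_curve.

Definition curve_mx : 'M[{poly k}]_n :=
  \sum_(i < (curve_deg L).+1) 'X^i *: map_mx polyC (@curve_coef L i).

Definition curve_at (z : k) : 'M[k]_n :=
  \sum_(i < (curve_deg L).+1) z ^+ i *: @curve_coef L i.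

Definition spectrum : set k := [set z | \det (curve_at z) = 0].

Definition alg_mult (z : k) : nat := mup z (\det curve_mx).

End OperatorCurves.

Section Schemes.
Variables (k : fieldType) (n : nat).

(* Coordinates on the space of n x n matrices are numbered by mxvec_index. The
   projection forgetting lambda is dual to mwiden, so that lambda is the last
   of the (n * n).+1 coordinates. *)
Definition generic_mx : 'M[{mpoly k[n * n]}]_n :=
  \matrix_(i, j) 'X_(mxvec_index i j).

Definition singular_ideal : set {mpoly k[n * n]} :=
  ideal_gen [set \det generic_mx].

Definition proj_preimage (I : set {mpoly k[n * n]}) :
    set {mpoly k[(n * n).+1]} :=
  ideal_gen (@mwiden (n * n) k @` I).

Definition resolution_ideal (L : operator_curve k n) :
    set {mpoly k[(n * n).+1]} :=
  ideal_gen [set p | exists i j,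
    p = mwiden (generic_mx i j) -
        (map_poly (@mpolyC (n * n).+1 k) (curve_mx L i j)).['X_ord_max]].

Definition point_of (T : 'M[k]_n) (z : k) : 'I_(n * n).+1 -> k :=
  fun i => if unlift ord_max i is Some j then mxvec T 0 j else z.

End Schemes.

Arguments singular_ideal k n : clear implicits.

(* Main.v *)
(* With [d] the generic determinant, [Rc] the local ring at [c], [B = Rc/P_L]
   and [delta = det L(lambda)], evaluation along the curve identifies [B] with
   the local ring of [k[lambda]] at the parameter value, [d] acting as
   [delta <> 0]. As [d] is regular on [Rc] and on [B], the higher
   [Tor_i (Rc/d, B)] vanish, while [Tor_0] is [B/delta B]; the latter is
   generated by one element and its submodules are the powers of
   [lambda - lambda_0], so its length is the order of vanishing of [delta]. *)

Require Import Defs.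
From HB Require Import structures.
From mathcomp Require Import all_boot all_algebra ring.
From mathcomp Require Import boolp classical_sets.
From mathcomp Require Import freeg mpoly.

Set Implicit Arguments.
Unset Strict Implicit.
Unset Printing Implicit Defensive.

Import GRing.Theory Defs.
Local Open Scope ring_scope.
Local Open Scope classical_set_scope.

(** * Tensor products, Tor and length *)

Section ModuleTheory.
Variable R : comNzRingType.
Implicit Types U V W M N : lmodType R.

(** Turns a function shown linear in the middle of a proof into a bundled map; every ad hoc linear
    map below is built this way. *)
Lemma linear_pack U V (f : U -> V) : linear f -> {g : {linear U -> V} | g =1 f}.
Proof.
move=> f_lin; pose fL := GRing.isLinear.Build R U V *:%R f f_lin.
by exists (HB.pack_for {linear U -> V} f fL).
Qed.

Lemma submoduleD V (B : set V) u v : submodule B -> B u -> B v -> B (u + v).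
Proof. by case=> _ sB Bu Bv; rewrite -[u]scale1r; apply: sB. Qed.

Lemma submoduleZ V (B : set V) a v : submodule B -> B v -> B (a *: v).
Proof. by case=> B0 sB Bv; rewrite -[a *: v]addr0; apply: sB. Qed.

Lemma span_incl V (A : set V) v : A v -> span A v.
Proof. by move=> Av B _; apply. Qed.

Lemma quotpi_eq0 V (A : set V) v : quotpi A v = 0 <-> span A v.
Proof. by rewrite -[v in span A v]subr0 -quotpi_eq linear0. Qed.

Lemma quotpi_surj V (A : set V) (q : quotmod A) : exists v, q = quotpi A v.
Proof. by exists (quotrepr q); rewrite quotreprK. Qed.

Lemma quotmod_lift V W (A : set V) (f : {linear V -> W}) :
  (forall v, A v -> f v = 0) ->
  {g : {linear quotmod A -> W} | forall v, g (quotpi A v) = f v}.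
Proof.
move=> fA0.
(* The zero set of [f] is a submodule containing [A], so the value of [f] on a class does not depend
   on the representative. *)
have f0 v : span A v -> f v = 0.
  move/(_ (fun w => f w = 0)); apply=> //.
  by split=> [|a u w fu fw]; rewrite ?linear0 // linearP fu fw scaler0 addr0.
have fE v : f (quotrepr (quotpi A v)) = f v.
  apply/eqP; rewrite -subr_eq0 -linearB; apply/eqP/f0/quotpi_eq.
  exact: quotreprK.
have /linear_pack[g gE] : linear (fun q : quotmod A => f (quotrepr q)).
  move=> a p q; rewrite -[p]quotreprK -[q]quotreprK -linearP !fE.
  by rewrite linearP.
by exists g => v; rewrite gE.
Qed.

Lemma freeg_ind (K : choiceType) (P : set {freeg K / R}) :
  submodule P -> (forall x, P << x >>) -> forall D, P D.
Proof.
move=> sP PU D; rewrite -[D]freeg_sumE.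
elim/big_ind: _ => [|x y|x _]; [by case: sP|exact: submoduleD|].
suff -> : << coeff x D *g x >> = coeff x D *: << x >> :> {freeg K / R}.
  exact: submoduleZ.
apply/eqP/freeg_eqP => y; rewrite coeffZ !coeffU.
by rewrite mul1r.
Qed.

Lemma fgliftU (K : choiceType) V (f : K -> V) x :
  fglift f (<< x >> : {freeg K / R}) = f x.
Proof. by rewrite liftU scale1r. Qed.

(** * Tensor products: generation by pure tensors and the universal property *)

Section TensorTheory.
Variables V W : lmodType R.

Definition pure_tensor (v : V) (w : W) : tensor V W :=
  quotpi _ (pure_pair v w).

Lemma pure_tensor_linearl w : linear (pure_tensor^~ w).
Proof.
move=> a u v; rewrite /pure_tensor -linearP; apply/quotpi_eq.
set x := pure_pair _ _.
(* The difference is one additivity relation plus one scaling relation. *)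
have -> : x - (a *: pure_pair u w + pure_pair v w) =
   (x - (pure_pair (a *: u) w + pure_pair v w)) +
   (pure_pair (a *: u) w - a *: pure_pair u w).
  by rewrite -[RHS]addrA; congr (_ + _); rewrite !opprD addrACA addNr add0r addrC.
apply: (submoduleD (span_submodule _)).
  by apply: span_incl; exact: TensorDl.
by apply: span_incl; exact: TensorZl.
Qed.

Lemma pure_tensor_linearr v : linear (pure_tensor v).
Proof.
move=> a u w; rewrite /pure_tensor -linearP; apply/quotpi_eq.
set x := pure_pair _ _.
have -> : x - (a *: pure_pair v u + pure_pair v w) =
   (x - (pure_pair v (a *: u) + pure_pair v w)) +
   (pure_pair v (a *: u) - a *: pure_pair v u).
  by rewrite -[RHS]addrA; congr (_ + _); rewrite !opprD addrACA addNr add0r addrC.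
apply: (submoduleD (span_submodule _)).
  by apply: span_incl; exact: TensorDr.
by apply: span_incl; exact: TensorZr.
Qed.

Lemma tensor_ind (P : set (tensor V W)) :
  submodule P -> (forall v w, P (pure_tensor v w)) -> forall t, P t.
Proof.
move=> [P0 PZD] Ppure t; have [x ->] := quotpi_surj t.
move: x; apply: freeg_ind => [|[v w]]; last exact: Ppure.
by split=> [|a u v]; rewrite ?linear0 // linearP; exact: PZD.
Qed.

Lemma tensor_ext U (f g : {linear tensor V W -> U}) :
  (forall v w, f (pure_tensor v w) = g (pure_tensor v w)) -> f =1 g.
Proof.
move=> fg t; apply: (tensor_ind (P := fun t => f t = g t)) => //.
by split=> [|a u v fgu fgv]; rewrite ?linear0 // !linearP fgu fgv.
Qed.

(** The extension of [b] to the free module on pairs kills the four families of relations because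
    [b] is bilinear, hence descends to the quotient. *)
Lemma tensor_lift U (b : V -> W -> U) :
  (forall w, linear (b^~ w)) -> (forall v, linear (b v)) ->
  {h : {linear tensor V W -> U} | forall v w, h (pure_tensor v w) = b v w}.
Proof.
move=> bl br; have [f fglE] :=
  linear_pack (fglift_is_linear (fun p : V * W => b p.1 p.2)).
have fE v w : f (pure_pair v w) = b v w by rewrite fglE /pure_pair fgliftU.
have blD w u v : b (u + v) w = b u w + b v w.
  by have := bl w 1 u v; rewrite !scale1r.
have brD v w w' : b v (w + w') = b v w + b v w'.
  by have := br v 1 w w'; rewrite !scale1r.
have bl0 w : b 0 w = 0.
  by apply: (addrI (b 0 w)); rewrite -blD !addr0.
have br0 v : b v 0 = 0.
  by apply: (addrI (b v 0)); rewrite -brD !addr0.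
have blZ a v w : b (a *: v) w = a *: b v w.
  by have := bl w a v 0; rewrite addr0 bl0 addr0.
have brZ a v w : b v (a *: w) = a *: b v w.
  by have := br v a w 0; rewrite addr0 br0 addr0.
have [|h hE] := @quotmod_lift _ _ (@tensor_rel R V W) f.
  move=> _ [v v' w|v w w'|a v w|a v w].
  - by rewrite linearB linearD /= !fE blD subrr.
  - by rewrite linearB linearD /= !fE brD subrr.
  - by rewrite linearB linearZ_LR /= !fE blZ subrr.
  - by rewrite linearB linearZ_LR /= !fE brZ subrr.
by exists h => v w; rewrite hE fE.
Qed.

End TensorTheory.

Lemma tensor_map_pure U V W (f : {linear U -> V}) u w :
  tensor_map W f (pure_tensor u w) = pure_tensor (f u) w.
Proof. by rewrite /pure_tensor tensor_map_pi free_tensor_map_pure. Qed.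


Lemma quotpiZ V (A : set V) a v : quotpi A (a *: v) = a *: quotpi A v.
Proof. exact: linearZ_LR. Qed.

Lemma quotpiB V (A : set V) u v : quotpi A (u - v) = quotpi A u - quotpi A v.
Proof. exact: linearB. Qed.

Lemma pure_tensorDl V W (u v : V) (w : W) :
  pure_tensor (u + v) w = pure_tensor u w + pure_tensor v w.
Proof. by have := pure_tensor_linearl w 1 u v; rewrite !scale1r. Qed.

Lemma pure_tensor0l V W (w : W) : pure_tensor (0 : V) w = 0.
Proof. by apply: (addrI (pure_tensor 0 w)); rewrite -pure_tensorDl !addr0. Qed.

Lemma pure_tensorZl V W a (v : V) (w : W) :
  pure_tensor (a *: v) w = a *: pure_tensor v w.
Proof.
by have := pure_tensor_linearl w a v 0; rewrite addr0 pure_tensor0l addr0.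
Qed.

Lemma pure_tensorBl V W (u v : V) (w : W) :
  pure_tensor (u - v) w = pure_tensor u w - pure_tensor v w.
Proof. by rewrite pure_tensorDl -scaleN1r pure_tensorZl scaleN1r. Qed.

Lemma pure_tensorDr V W (v : V) (w w' : W) :
  pure_tensor v (w + w') = pure_tensor v w + pure_tensor v w'.
Proof. by have := pure_tensor_linearr v 1 w w'; rewrite !scale1r. Qed.

Lemma pure_tensor0r V W (v : V) : pure_tensor v (0 : W) = 0.
Proof. by apply: (addrI (pure_tensor v 0)); rewrite -pure_tensorDr !addr0. Qed.

Lemma pure_tensorZr V W a (v : V) (w : W) :
  pure_tensor v (a *: w) = a *: pure_tensor v w.
Proof.
by have := pure_tensor_linearr v a w 0; rewrite addr0 pure_tensor0r addr0.
Qed.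

Lemma span_id V (B : set V) : submodule B -> span B `<=` B.
Proof. by move=> sB v /(_ B sB); apply. Qed.

Lemma range_submodule U V (f : {linear U -> V}) : submodule (range f).
Proof.
split=> [|a _ _ [x _ <-] [y _ <-]]; first by exists 0; rewrite ?linear0.
by exists (a *: x + y); rewrite ?linearP.
Qed.

Lemma tensor_map_comp U V W N (f : {linear U -> V}) (g : {linear V -> W})
    (h : {linear U -> W}) :
  (forall u, h u = g (f u)) ->
  forall t, tensor_map N h t = tensor_map N g (tensor_map N f t).
Proof.
move=> hE t; apply: (tensor_ext (f := tensor_map N h)
  (g := tensor_map N g \o tensor_map N f)) => u w /=.
by rewrite !tensor_map_pure hE.
Qed.

(* An inverse of [V (x) N / f_*(U (x) N) -> W (x) N] is built from arbitrary
   lifts along [g]. *)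
Lemma tensor_right_exact U V W N (f : {linear U -> V}) (g : {linear V -> W}) :
    (forall w, exists v, g v = w) ->
    (forall v, g v = 0 -> exists u, f u = v) ->
  forall t, tensor_map N g t = 0 -> exists u, tensor_map N f u = t.
Proof.
move=> g_surj fg_exact t gt0.
pose sg w := sval (cid (g_surj w)).
have sgK w : g (sg w) = w by exact: svalP (cid (g_surj w)).
pose C : lmodType R := quotmod (range (tensor_map N f)).
pose piC : tensor V N -> C := quotpi _.
(* Two lifts of the same element differ by the image of [f], so the class in [C] is independent of
   the lift; this also gives linearity of the inverse. *)
have piC0 v v' n : g v = g v' -> piC (pure_tensor v n) = piC (pure_tensor v' n).
  move=> gv; apply/quotpi_eq; apply: span_incl.
  have [|u uE] := fg_exact (v - v'); first by rewrite linearB gv subrr.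
  exists (pure_tensor u n); rewrite // tensor_map_pure uE.
  by rewrite pure_tensorBl.
have [||h hE] := @tensor_lift W N C (fun w n => piC (pure_tensor (sg w) n)).
- move=> n a u v /=.
  rewrite -linearP -pure_tensor_linearl; apply: piC0.
  by rewrite linearP !sgK.
- by move=> w a u v /=; rewrite -linearP -pure_tensor_linearr.
have hg : forall s, h (tensor_map N g s) = piC s.
  apply: (tensor_ext (f := h \o tensor_map N g) (g := quotpi _)) => v n /=.
  by rewrite tensor_map_pure hE; apply: piC0; rewrite sgK.
have /quotpi_eq0/(span_id (range_submodule _))[u _ <-] : piC t = 0.
  by rewrite -hg gt0 linear0.
by exists u.
Qed.

Lemma homology_eq0 U V W (f : {linear U -> V}) (g : {linear V -> W}) :
    (forall v, g v = 0 -> exists u, f u = v) ->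
  forall x : homology f g, x = 0.
Proof.
move=> exact_fg x; have [z ->] := quotpi_surj x.
apply/quotpi_eq0; apply: span_incl => /=.
by have [u uE] := exact_fg (val z) (eqP (valP z)); exists u.
Qed.

(** * The canonical free resolution and vanishing criteria for Tor *)

Lemma augmentation_surj V v : exists x : {freeg V / R}, augmentation x = v.
Proof. by exists << v >>; rewrite /augmentation fgliftU. Qed.

Lemma free_res_exact (M : lmodType R) j (x : free_res M j) :
  augmentation x = 0 -> exists u : free_res M j.+1, free_res_d u = x.
Proof.
move/eqP=> x0; pose z : kernel (@augmentation R (syzygy M j)) := Sub x x0.
by exists << z >>; rewrite /free_res_d /augmentation fgliftU /z SubK.
Qed.

Lemma augmentation_free_res_d (M : lmodType R) j (u : free_res M j.+1) :
  augmentation (free_res_d u) = 0.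
Proof. exact: (eqP (valP (augmentation u))). Qed.

Definition kernel_incl U V (f : {linear U -> V}) : kernel f -> U := val.

Lemma kernel_incl_is_linear U V (f : {linear U -> V}) : linear (@kernel_incl U V f).
Proof. by move=> a u v; rewrite /kernel_incl linearP. Qed.

HB.instance Definition _ U V (f : {linear U -> V}) :=
  GRing.isLinear.Build R (kernel f) U *:%R (@kernel_incl U V f)
    (@kernel_incl_is_linear U V f).

Lemma kernel_inclE U V (f : {linear U -> V}) (x : kernel f) :
  f (kernel_incl x) = 0.
Proof. exact: (eqP (valP x)). Qed.

Lemma kernel_incl_inj U V (f : {linear U -> V}) : injective (@kernel_incl U V f).
Proof. exact: val_inj. Qed.

Lemma kernel_lift U V W (f : {linear U -> V}) (h : {linear W -> U}) :
    (forall w, f (h w) = 0) ->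
  {g : {linear W -> kernel f} | forall w, kernel_incl (g w) = h w}.
Proof.
move=> fh0.
have h_ker w : h w \in in_kernel f by rewrite unfold_in /in_kernel fh0.
pose g w : kernel f := Sub (h w) (h_ker w).
have gE w : kernel_incl (g w) = h w by rewrite /kernel_incl /g SubK.
have /linear_pack[g' g'E] : linear g.
  by move=> a u v; apply: kernel_incl_inj; rewrite linearP !gE linearP.
by exists g' => w; rewrite g'E.
Qed.

Definition syzygy_incl (M : lmodType R) j :
  {linear syzygy M j.+1 -> free_res M j} := @kernel_incl _ _ _.

(** The differential out of [F_(j+1)] factors as the augmentation onto [Z_(j+1)] followed by the
    inclusion into [F_j]. If the latter stays injective after tensoring, a cycle dies already in
    [Z_(j+1)] tensored with [N], and right exactness makes it a boundary. *)
Lemma Tor_eq0 M N j :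
    (forall t, tensor_map N (@syzygy_incl M j) t = 0 -> t = 0) ->
  forall x : Tor j.+1 M N, x = 0.
Proof.
move=> incl_inj; apply: homology_eq0 => t dt0.
apply: (tensor_right_exact (g := @augmentation R (syzygy M j.+1))).
- exact: augmentation_surj.
- exact: free_res_exact.
- by apply: incl_inj; rewrite -dt0; apply/esym/tensor_map_comp.
Qed.

(** Projectivity of free modules against the canonical cover: the basis element at [x] goes to the
    generator indexed by [r << x >>]. *)
Lemma freeg_cover (F : choiceType) V (r : {linear {freeg F / R} -> V}) :
  {s : {linear {freeg F / R} -> {freeg V / R}} | forall x, augmentation (s x) = r x}.
Proof.
have [s sE] := linear_pack
  (fglift_is_linear (fun x : F => << r << x >> >> : {freeg V / R})).
exists s; apply: freeg_ind => [|y].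
  split=> [|a u v su sv]; first by rewrite !linear0.
  by rewrite (linearP s) (linearP (@augmentation _ _)) /= su sv linearP.
by rewrite sE fgliftU /augmentation fgliftU.
Qed.

Lemma split_incl_section (F : choiceType) V (i : {linear V -> {freeg F / R}})
    (r : {linear {freeg F / R} -> V}) : cancel i r ->
  {s : {linear V -> {freeg V / R}} | forall x, augmentation (s x) = x}.
Proof.
move=> irK; have [s sE] := freeg_cover r.
by exists (s \o i) => x /=; rewrite sE irK.
Qed.

(** The retraction is [x - s (augmentation x)], the projection onto the kernel along the image of
    [s]. *)
Lemma syzygy_section_next M j (s : {linear syzygy M j -> free_res M j}) :
    (forall x, augmentation (s x) = x) ->
  {r : {linear free_res M j -> syzygy M j.+1} | cancel (@syzygy_incl M j) r}.
Proof.
move=> sK.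
have /linear_pack[h hE] : linear (fun x => x - s (augmentation x)).
  move=> a u v; rewrite (linearP (@augmentation _ _)) (linearP s).
  by rewrite opprD addrACA scalerBr.
have [|r rE] := @kernel_lift _ _ _ (@augmentation R (syzygy M j)) h.
  by move=> x; rewrite hE linearB /= sK subrr.
exists r => x; apply: kernel_incl_inj.
by rewrite rE hE kernel_inclE linear0 subr0.
Qed.

Lemma tensor_map_inj_split U V N (i : {linear U -> V}) (r : {linear V -> U}) :
  cancel i r -> forall t, tensor_map N i t = 0 -> t = 0.
Proof.
move=> irK t it0.
have <- : tensor_map N idfun t = t.
  apply: (tensor_ext (f := tensor_map N idfun) (g := idfun)) => u w.
  exact: (tensor_map_pure idfun u w).
by rewrite (tensor_map_comp (f := i) (g := r)) ?it0 ?linear0 // => u /=.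
Qed.

(* A section of [F_j -> Z_j] makes [Z_(j+1)] a direct summand of [F_j]; being a
   summand of a free module, [Z_(j+1)] has a section in turn. *)
Lemma Tor_split_eq0 M N (s : {linear syzygy M 1 -> free_res M 1}) :
    (forall x, augmentation (s x) = x) ->
  forall j (x : Tor j.+2 M N), x = 0.
Proof.
move=> sK j.
have [sj sjK] : {s : {linear syzygy M j.+1 -> free_res M j.+1} |
    forall x, augmentation (s x) = x}.
  elim: j => [|j [sj /syzygy_section_next[r rK]]]; first by exists s.
  exact: (split_incl_section rK).
apply: Tor_eq0; have [r rK] := syzygy_section_next sjK.
exact: tensor_map_inj_split rK.
Qed.

Lemma linear_regular V (f : {linear R^o -> V}) a : f a = a *: f 1.
Proof. by rewrite -linearZ_LR /= /GRing.scale /= mulr1. Qed.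

Lemma tensor_regular N (t : tensor R^o N) : exists n, t = pure_tensor (1 : R^o) n.
Proof.
move: t; apply: tensor_ind => [|a n].
  split=> [|a _ _ [n ->] [n' ->]]; first by exists 0; rewrite pure_tensor0r.
  by exists (a *: n + n'); rewrite pure_tensor_linearr.
exists (a *: n); rewrite pure_tensorZr -pure_tensorZl.
by rewrite [a *: (1 : R^o)]mulr1.
Qed.

(** Multiplication [a, n |-> a *: n] identifies the tensor product of [R] and [N] with [N], where
    [d] acts injectively. *)
Lemma tensor_regular_torsion_free N d :
    (forall n : N, d *: n = 0 -> n = 0) ->
  forall t : tensor R^o N, d *: t = 0 -> t = 0.
Proof.
move=> dN t; have [n ->] := tensor_regular t.
have [n'|a u v w|h hE] := tensor_lift (V := R^o) (W := N) (b := fun a n => a *: n).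
- by move=> a u v; rewrite scalerDl scalerA.
- by rewrite scalerDr !scalerA mulrC.
rewrite -pure_tensorZr => /(congr1 h); rewrite hE linear0 scale1r.
by move/dN => ->; rewrite pure_tensor0r.
Qed.

(** * Vanishing of higher Tor for the quotient by a regular element *)

Section TorPrincipal.
Variables (A : set R^o) (d : R) (N : lmodType R).
Hypothesis spanA : forall x : R^o, span A x <-> exists a, x = a * d.
Hypothesis d_reg : forall a, a * d = 0 -> a = 0.
Hypothesis dN_reg : forall n : N, d *: n = 0 -> n = 0.
Let M : lmodType R := quotmod A.
Let e : free_res M 0 := << quotpi A (1 : R^o) >>.

(* [F_0 = R e (+) ker phi], and [Z_1 = R d e (+) ker phi] *)
Let phi_ex : {phi : {linear free_res M 0 -> R^o} |
  (forall x, augmentation x = quotpi A (phi x)) & phi e = 1}.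
Proof.
(* An arbitrary choice of representatives, except that the class of 1 must be sent to 1 to get
   [phi e = 1]. *)
pose f (q : M) : R^o := if q == quotpi A (1 : R^o) then 1 else quotrepr q.
have [phi phiE] := linear_pack (fglift_is_linear f).
exists phi; last by rewrite phiE fgliftU /f eqxx.
apply: freeg_ind => [|q].
  split=> [|a u v hu hv]; first by rewrite !linear0.
  by rewrite (linearP (@augmentation _ _)) /= hu hv (linearP phi) [in RHS]linearP.
rewrite /augmentation fgliftU phiE fgliftU /f /=.
by case: eqP => [->|_] //; rewrite quotreprK.
Qed.

(** For [x] in [Z_1], [phi x] is zero modulo [A], hence equals [alpha x * d]. The decomposition is
    [x = phi x *: e + (x - phi x *: e)], with [delta a = (a * d) *: e] and
    [rho x = x - phi x *: e]. *)
Lemma syzygy1_decomp : exists (phi : {linear free_res M 0 -> R^o})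
    (alpha : {linear syzygy M 1 -> R^o}) (delta : {linear R^o -> syzygy M 1})
    (rho : {linear free_res M 0 -> syzygy M 1}),
  (forall x, phi (syzygy_incl M 0 x) = d *: alpha x) /\
  (forall x, x = delta (alpha x) + rho (syzygy_incl M 0 x)).
Proof.
have [phi augE phi_e] := phi_ex.
have alpha_ex (x : syzygy M 1) : exists a, phi (syzygy_incl M 0 x) = a * d.
  by apply/spanA/quotpi_eq0; rewrite -augE; exact: kernel_inclE.
pose alpha x : R^o := sval (cid (alpha_ex x)).
have alphaE x : phi (syzygy_incl M 0 x) = alpha x * d.
  exact: svalP (cid (alpha_ex x)).
(* [alpha] is chosen pointwise; regularity of [d] makes the quotient unique, hence linear. *)
have /linear_pack[alpha' alpha'E] : linear alpha.
  move=> a u v; apply/eqP; rewrite -subr_eq0; apply/eqP/d_reg.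
  rewrite mulrBl -alphaE mulrDl -[_ * d]mulrA -!alphaE linearP (linearP phi).
  by rewrite subrr.
have [|h hE] := linear_pack (f := fun a : R^o => (a * d) *: e).
  by move=> a u v /=; rewrite mulrDl scalerDl scalerA mulrA.
have [|delta deltaE] := kernel_lift (f := @augmentation R M) (h := h).
  move=> a; rewrite hE linearZ_LR /= augE phi_e -linearZ_LR.
  by apply/quotpi_eq0/spanA; exists a; rewrite /GRing.scale /= mulr1.
have [|g gE] := linear_pack (f := fun x => x - phi x *: e).
  move=> a u v; rewrite (linearP phi) scalerDl opprD addrACA.
  by rewrite scalerBr scalerA.
have [|rho rhoE] := kernel_lift (f := @augmentation R M) (h := g).
  move=> x; rewrite gE linearB linearZ_LR /= !augE phi_e -linearZ_LR -linearB.
  by rewrite /GRing.scale /= mulr1 subrr linear0.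
exists phi, alpha', delta, rho; split=> x.
  by rewrite alphaE alpha'E mulrC.
apply: kernel_incl_inj; rewrite linearD /= deltaE rhoE hE gE alphaE alpha'E.
by rewrite addrC subrK.
Qed.

(** In degree 1, let [t] vanish under the tensored inclusion. Then [d] kills the image of [t] under
    the tensored [alpha], so that image is zero, and both terms of the decomposition of [t] vanish.
    In higher degrees the decomposition yields a section of [F_1 -> Z_1]. *)
Lemma Tor_principal_eq0 j (x : Tor j.+1 M N) : x = 0.
Proof.
have [phi [alpha [delta [rho [phiE decomp]]]]] := syzygy1_decomp.
case: j x => [|j].
  apply: Tor_eq0 => t it0.
  have at0 : tensor_map N alpha t = 0.
    apply: (tensor_regular_torsion_free dN_reg).
    have [|da daE] := linear_pack (f := fun x => d *: alpha x).
      by move=> a u v; rewrite linearP scalerDr !scalerA mulrC.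
    suff <- : tensor_map N phi (tensor_map N (syzygy_incl M 0) t) =
        d *: tensor_map N alpha t.
      by rewrite it0 linear0.
    rewrite -(tensor_map_comp (h := da)); last by move=> u; rewrite daE phiE.
    apply: (tensor_ext (f := tensor_map N da)
      (g := d \*: tensor_map N alpha)) => u n /=.
    by rewrite !tensor_map_pure daE pure_tensorZl.
  rewrite [t](_ : t = tensor_map N delta (tensor_map N alpha t) +
     tensor_map N rho (tensor_map N (syzygy_incl M 0) t)).
    by rewrite at0 it0 !linear0 addr0.
  apply: (tensor_ext (f := idfun) (g := (tensor_map N delta \o tensor_map N alpha)
     \+ (tensor_map N rho \o tensor_map N (syzygy_incl M 0)))) => u n /=.
  by rewrite !tensor_map_pure {1}[u]decomp pure_tensorDl.
(* The section lifts each summand separately: [delta (alpha x)] through a generator over [delta 1],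
   and the [rho] part through the cover [s]. *)
have [s sE] := freeg_cover rho.
pose e1 : free_res M 1 := << delta 1 >>.
have [|s1 s1E] := linear_pack (f := fun x => alpha x *: e1 + s (syzygy_incl M 0 x)).
  move=> a u v; rewrite (linearP alpha) (linearP (syzygy_incl M 0)) (linearP s).
  by rewrite scalerDl scalerDr addrACA scalerA.
apply: (Tor_split_eq0 (s := s1)) => x.
rewrite s1E linearD linearZ_LR /= sE /augmentation fgliftU -linear_regular.
by rewrite -decomp.
Qed.

End TorPrincipal.

(** * Tor in degree 0 as a cyclic module, and the annihilator of its generator *)

Section TorZero.
Variables A B : set R^o.
Let M : lmodType R := quotmod A.
Let N : lmodType R := quotmod B.

Definition Tor0_unit : Tor 0 M N :=
  quotpi _ (pure_tensor (<< quotpi A (1 : R^o) >> : free_res M 0) (quotpi B (1 : R^o))).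

Lemma quotpi_regular (C : set R^o) (r : R) : quotpi C r = r *: quotpi C (1 : R^o).
Proof. by rewrite (linear_regular (quotpi C)). Qed.

Lemma Tor0_ker (x : free_res M 0) n : augmentation x = 0 ->
  (quotpi _ (pure_tensor x n) : Tor 0 M N) = 0.
Proof.
move=> /free_res_exact[u <-]; apply/quotpi_eq0; apply: span_incl.
by exists (pure_tensor u n); rewrite // tensor_map_pure.
Qed.

Lemma Tor0_unit_gen (v : Tor 0 M N) : exists r, v = r *: Tor0_unit.
Proof.
have [t ->] := quotpi_surj v; move: t; apply: tensor_ind => [|x n].
  split=> [|a u w [r ru] [s sw]]; first by exists 0; rewrite scale0r linear0.
  by exists (a * r + s); rewrite linearP /= ru sw scalerDl scalerA.
(* With [a] lifting [augmentation x], the element [x - a *: e0] is in the kernel of the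
   augmentation, so [x] may be replaced by [a *: e0]. *)
have [a aE] := quotpi_surj (augmentation x).
have [s ->] := quotpi_surj n; exists (s * a); rewrite /Tor0_unit.
set e0 : free_res M 0 := << _ >>; set n0 := quotpi B (1 : R^o).
have e0E : augmentation e0 = quotpi A (1 : R^o) by rewrite /augmentation fgliftU.
rewrite (quotpi_regular B) pure_tensorZr quotpiZ -scalerA.
congr (_ *: _); apply/eqP; rewrite -subr_eq0 -quotpiZ -pure_tensorZl.
rewrite -quotpiB -pure_tensorBl; apply/eqP; apply: Tor0_ker.
by rewrite linearB linearZ_LR /= e0E aE (quotpi_regular A) subrr.
Qed.

Lemma Tor0_unit_annl r : span A r -> r *: Tor0_unit = 0.
Proof.
move=> Ar; rewrite /Tor0_unit.
set e0 : free_res M 0 := << _ >>; set n0 := quotpi B (1 : R^o).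
rewrite -quotpiZ -pure_tensorZl; apply: Tor0_ker.
by rewrite linearZ_LR /= /augmentation fgliftU -quotpi_regular; apply/quotpi_eq0.
Qed.

Lemma Tor0_unit_annr r : span B r -> r *: Tor0_unit = 0.
Proof.
move=> Br; rewrite /Tor0_unit.
set e0 : free_res M 0 := << _ >>.
rewrite -quotpiZ -pure_tensorZr -quotpi_regular.
by rewrite (iffRL (quotpi_eq0 _ _) Br) pure_tensor0r linear0.
Qed.

(** Multiplication of classes gives a map from the tensor product of [R/A] and [R/B] to [R/C].
    Composed with the augmentation it kills boundaries and sends the generator to 1, so an
    annihilator of the generator lies in [C]. *)
Lemma Tor0_unit_ann_inv (C : set R^o) r :
  submodule C -> A `<=` C -> B `<=` C -> r *: Tor0_unit = 0 -> C r.
Proof.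
move=> sC AC BC re0.
have [|gA gAE] := quotmod_lift (f := quotpi C) (A := A).
  by move=> x Ax; apply/quotpi_eq0; apply: span_incl; exact: AC.
have [|gB gBE] := quotmod_lift (f := quotpi C) (A := B).
  by move=> x Bx; apply/quotpi_eq0; apply: span_incl; exact: BC.
(* The left form is visibly linear in the first argument, the right form in the second; their
   equality gives bilinearity. *)
have bE (x : R^o) (n : N) : quotrepr n *: gA (quotpi A x) = x *: gB n.
  rewrite gAE -[n in RHS]quotreprK gBE /= (quotpi_regular C x).
  by rewrite (quotpi_regular _ (quotrepr n)) !scalerA mulrC.
have [n|m|h hE] := tensor_lift (b := fun (m : M) (n : N) => quotrepr n *: gA m).
- by move=> a u v /=; rewrite linearP scalerDr !scalerA mulrC.
- move=> a u v /=; have [x ->] := quotpi_surj m.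
  by rewrite !bE linearP scalerDr !scalerA mulrC.
have aug_d t : tensor_map N (@augmentation R M)
    (tensor_map N (@free_res_d R M 0) t) = 0.
  apply: (tensor_ext (f := tensor_map N (@augmentation R M) \o
     tensor_map N (@free_res_d R M 0)) (g := \0)) => u n /=.
  rewrite !tensor_map_pure -[RHS](pure_tensor0l M n); congr pure_tensor.
  exact: (augmentation_free_res_d (M := M) (j := 0) u).
move: re0; rewrite /Tor0_unit -quotpiZ.
move=> /quotpi_eq0/(span_id (range_submodule _))[u _ uE].
have := aug_d u; rewrite uE linearZ_LR /= tensor_map_pure => /(congr1 h).
rewrite linear0 linearZ_LR /= hE /augmentation fgliftU bE scale1r gBE /=.
rewrite -quotpi_regular.
by move/quotpi_eq0; exact: span_id.
Qed.

End TorZero.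

(** * Length of modules *)

Lemma is_length_module_length V l : is_length V l -> module_length V = Some l.
Proof.
move=> [cl lmax]; rewrite /module_length; case: pselect => [ex|[]]; last by exists l.
case: (cid ex) => l' [cl' l'max] /=; congr Some; apply/eqP.
by rewrite eqn_leq lmax ?l'max.
Qed.

Lemma module_length0 V : (forall v : V, v = 0) -> module_length V = Some 0%N.
Proof.
move=> V0; apply: is_length_module_length; split.
  exists (fun=> [set 0]); split=> // i _; split=> // a u v _ _.
  by rewrite /= [LHS]V0.
case=> // l [B [sB /(_ 0%N isT)[_ []]]] v _; rewrite [v]V0.
by have [] := sB 0%N isT.
Qed.

(* Along a strict chain, the least [i] with [t ^+ i *: e] in the submodule
   strictly decreases. *)
Lemma uniserial_length V (e : V) (t : R) m :
    (forall v, v = 0 \/ exists u u' i, u' * u = 1 /\ v = (u * t ^+ i) *: e) ->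
    (forall i, t ^+ i *: e = 0 <-> (m <= i)%N) ->
  is_length V m.
Proof.
move=> Vt te0; split.
  (* The chain of submodules generated by [t ^+ (m - i) *: e], increasing from 0. *)
  exists (fun i => [set v | exists r, v = (r * t ^+ (m - i)) *: e]); split.
    move=> i _; split=> [|a u v [r ->] [s ->]].
      by exists 0; rewrite mul0r scale0r.
    by exists (a * r + s); rewrite scalerA -scalerDl mulrDl mulrA.
  move=> i im; split=> [v [r ->]|sub].
    by exists (r * t); rewrite -mulrA -exprS -subSn // subSS.
  have [|r] := sub (t ^+ (m - i.+1) *: e); first by exists 1; rewrite mul1r.
  (* Multiplying by [t ^+ i] turns the right side into a multiple of [t ^+ m *: e = 0], while the
     exponent on the left becomes [m - 1]. *)
  move/(congr1 (fun v => t ^+ i *: v)); rewrite !scalerA mulrCA -!exprD.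
  rewrite subnKC 1?ltnW // -scalerA (iffRL (te0 m) (leqnn m)) scaler0.
  by move/te0; rewrite -{1}(subnKC im) addSn ltnn.
move=> l [B [sB Bprop]].
(* The exponent starts at [m], where [t ^+ m *: e = 0], and drops at each of the [l] strict
   inclusions, so [l <= m]. *)
suff H i : (i <= l)%N -> exists2 j, (j + i <= m)%N & B i (t ^+ j *: e).
  by have [j jm _] := H l (leqnn l); exact: leq_trans (leq_addl j l) jm.
elim: i => [_|i IHi il].
  exists m; first by rewrite addn0.
  by rewrite (iffRL (te0 m) (leqnn m)); case: (sB 0%N).
have [j jm Bj] := IHi (ltnW il).
have [_ /existsNP[v /not_implyP[Bv nBv]]] := Bprop i il.
have [v0|[u [u' [p [uu' vE]]]]] := Vt v.
  by case: nBv; rewrite v0; case: (sB i (ltnW il)).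
exists p.
  rewrite addnS; apply: leq_trans jm; rewrite -addSn leq_add2r ltnNge.
  apply/negP => jp; apply: nBv; rewrite vE -(subnK jp) exprD mulrA -scalerA.
  exact: (submoduleZ _ (sB i (ltnW il))).
have -> : t ^+ p *: e = u' *: v by rewrite vE scalerA mulrA uu' mul1r.
exact: (submoduleZ _ (sB i.+1 il)).
Qed.

End ModuleTheory.

(** * A divisor and a parametrised curve in the local ring of a point *)

(** Clears denominators in [r * x + y], where [r], [x], [y] have denominators [s], [q], [q']. *)
Lemma scale_frac (S : comNzRingType) (r x y s q q' : S) :
  (r * x + y) * (s * q * q') = r * s * (x * q) * q' + y * q' * s * q.
Proof. ring. Qed.

Lemma scale_eq_frac (S : comNzRingType) (V : lmodType S) (r w q p u s : S) (e : V) :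
  w * q = 1 -> r * q = p -> p *: e = (u * s) *: e -> r *: e = (w * u * s) *: e.
Proof.
by move=> wq <- E; rewrite -mulrA -[RHS]scalerA -E scalerA mulrCA wq mulr1.
Qed.

Lemma scale_unit_eq0 (S : comNzRingType) (V : lmodType S) (u u' s : S) (e : V) :
  u' * u = 1 -> (u * s) *: e = 0 -> s *: e = 0.
Proof. by move=> uu' use0; rewrite -[s]mul1r -uu' -mulrA -scalerA use0 scaler0. Qed.

Lemma alternating_sum_concentrated (len : nat -> option nat) N m :
    len 0%N = Some m -> (forall j, len j.+1 = Some 0%N) ->
  (if [forall i : 'I_N.+1, isSome (len i)]
   then Some (\sum_(i < N.+1) (-1) ^+ i * (odflt 0%N (len i))%:Z)
   else None) = Some m%:Z.
Proof.
move=> len0 lenS; rewrite (_ : [forall i, _]); last first.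
  by apply/forallP => -[[|j] j_lt] /=; rewrite ?len0 ?lenS.
rewrite big_ord_recl len0 expr0 mul1r big1 ?addr0 // => i _.
by rewrite lenS mulr0.
Qed.

Section LocalCurve.
Variables (k : fieldType) (N : nat) (c : 'I_N -> k).
Local Notation Rc := (local_ring c).
Local Notation loc := (@to_local k N c).

Lemma to_localM p q : loc (p * q) = loc p * loc q.
Proof. by apply: val_inj; rewrite /= rmorphM. Qed.

Lemma to_localD p q : loc (p + q) = loc p + loc q.
Proof. by apply: val_inj; rewrite /= rmorphD. Qed.

Lemma to_local0 : loc 0 = 0.
Proof. by apply: val_inj; rewrite /= rmorph0. Qed.

Lemma to_local1 : loc 1 = 1.
Proof. by apply: val_inj; rewrite /= rmorph1. Qed.

Lemma to_localX p i : loc (p ^+ i) = loc p ^+ i.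
Proof. by elim: i => [|i IHi]; rewrite ?to_local1 // !exprS to_localM IHi. Qed.

Lemma to_local_inj : injective loc.
Proof. by move=> p q /(congr1 val) /= /eqP; rewrite tofrac_eq => /eqP. Qed.

Lemma local_mulI (x : Rc) d : d != 0 -> x * loc d = 0 -> x = 0.
Proof.
move=> d0 /(congr1 val) /= /eqP; rewrite mulf_eq0 tofrac_eq0 (negPf d0) orbF.
by move/eqP => x0; apply: val_inj.
Qed.

Lemma to_local_unit q : q.@[c] != 0 -> exists u : Rc, u * loc q = 1.
Proof.
move=> qc; have u_reg : 1 / tofrac q \in regular_at c.
  by apply/asboolP; exists 1, q; rewrite rmorph1.
exists (@exist _ (fun x => x \in regular_at c) _ u_reg); apply: val_inj.
rewrite /= div1r mulVf //.
by rewrite tofrac_eq0; apply: contra_neq qc => ->; rewrite meval0.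
Qed.

Lemma local_frac (x : Rc) : exists p q, q.@[c] != 0 /\ x * loc q = loc p.
Proof.
case: x => x /= xP; have /asboolP[p [q [qc xE]]] := xP.
exists p, q; split=> //; apply: val_inj; rewrite /= xE divfK //.
by rewrite tofrac_eq0; apply: contra_neq qc => ->; rewrite meval0.
Qed.

(** [sigma] restricts functions to a parametrised curve through [c] at parameter [z], and [iota] is
    a section of it. [I] is the ideal of the curve and [D] that of a divisor not containing it. *)
Variables (z : k) (sigma : {rmorphism {mpoly k[N]} -> {poly k}}).
Variables (iota : {rmorphism {poly k} -> {mpoly k[N]}}) (d : {mpoly k[N]}).
Variables D I : set {mpoly k[N]}.
Hypothesis sigma_c : forall p, (sigma p).[z] = p.@[c].
Hypothesis iotaK : cancel iota sigma.
Hypothesis D_def : forall p, D p <-> exists a, p = a * d.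
Hypothesis I_def : forall p, I p <-> sigma p = 0.
Hypothesis sigma_d : sigma d != 0.

Let A : set Rc^o := loc @` D.
Let B : set Rc^o := loc @` I.

Lemma sigma_neq0 q : q.@[c] != 0 -> sigma q != 0.
Proof. by apply: contra_neq => q0; rewrite -sigma_c q0 horner0. Qed.

(* For [a = 0] this is the extension of [I] to the local ring. *)
Definition sigma_dvd (a : {poly k}) : set Rc^o :=
  [set x | exists p q, [/\ q.@[c] != 0, x * loc q = loc p & a %| sigma p]].

Lemma sigma_dvd_submodule a : submodule (sigma_dvd a).
Proof.
split=> [|r x y [p [q [qc xE ap]]] [p' [q' [q'c yE ap']]]].
  exists 0, 1; rewrite meval1 oner_neq0 rmorph0 dvdp0.
  by split=> //; rewrite mul0r to_local0.
have [b [s [sc rE]]] := local_frac r.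
exists (b * p * q' + p' * s * q), (s * q * q'); split.
- by rewrite !mevalM !mulf_neq0.
- rewrite to_localD !to_localM -rE -xE -yE; exact: scale_frac.
- rewrite rmorphD !rmorphM; apply: dvdp_add; apply: dvdp_mulr.
    exact: dvdp_mull.
  exact: dvdp_mulr.
Qed.

(** Passing from the witnessing fraction to another fraction of [x] is a cross multiplication; the
    extra factor [sigma q'] does not vanish at [z]. *)
Lemma sigma_dvd_frac a (x : Rc) p q : q.@[c] != 0 -> x * loc q = loc p ->
  sigma_dvd a x -> exists2 q', q'.@[c] != 0 & a %| sigma p * sigma q'.
Proof.
move=> qc xE [p' [q' [q'c xE' ap']]]; exists q' => //.
suff pq : p * q' = p' * q by rewrite -rmorphM pq rmorphM dvdp_mulr.
by apply: to_local_inj; rewrite !to_localM -xE -xE' mulrAC.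
Qed.

Lemma sub_kernel_sigma_dvd a : B `<=` sigma_dvd a.
Proof.
move=> _ [p /I_def p0 <-]; exists p, 1.
by rewrite meval1 oner_neq0 to_local1 mulr1 p0 dvdp0.
Qed.

Lemma sub_divisor_sigma_dvd a : a %| sigma d -> A `<=` sigma_dvd a.
Proof.
move=> ad _ [_ /D_def[b ->] <-]; exists (b * d), 1.
by rewrite meval1 oner_neq0 to_local1 mulr1 rmorphM dvdp_mull.
Qed.

Lemma span_divisor (x : Rc^o) : span A x <-> exists a, x = a * loc d.
Proof.
split=> [|[a ->]].
  move/(_ (fun x => exists a, x = a * loc d)); apply.
    split=> [|r _ _ [a ->] [b ->]]; first by exists 0; rewrite mul0r.
    by exists (r * a + b); rewrite mulrDl -mulrA.
  by move=> _ [_ /D_def[b ->] <-]; exists (loc b); rewrite to_localM.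
apply: (submoduleZ a (span_submodule A)); apply: span_incl.
by exists d => //; apply/D_def; exists 1; rewrite mul1r.
Qed.

Lemma span_kernel (x : Rc) p q :
  q.@[c] != 0 -> x * loc q = loc p -> sigma p = 0 -> span B x.
Proof.
move=> /to_local_unit[u uq] xE p0.
have -> : x = u * loc p by rewrite -xE mulrCA uq mulr1.
apply: (submoduleZ u (span_submodule B)); apply: span_incl.
by exists p => //; apply/I_def.
Qed.

(** If [d * x] lies in the extension of [I], with [x = p / q], then [sigma d * sigma p] times a
    nonzero polynomial is 0 in the domain [{poly k}], so [sigma p = 0]. *)
Lemma divisor_regular (n : quotmod B) : loc d *: n = 0 -> n = 0.
Proof.
have [x ->] := quotpi_surj n; rewrite -quotpiZ => /quotpi_eq0 dx.
have {}dx := dx _ (sigma_dvd_submodule 0) (@sub_kernel_sigma_dvd 0).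
have [p [q [qc xE]]] := local_frac x.
have [|q' q'c] := sigma_dvd_frac qc _ dx (p := d * p).
  by rewrite to_localM -xE mulrA.
rewrite dvd0p rmorphM -mulrA !mulf_eq0 (negPf sigma_d).
rewrite (negPf (sigma_neq0 q'c)) orbF => /eqP p0.
by apply/quotpi_eq0; exact: (span_kernel qc xE p0).
Qed.

Let m := mup z (sigma d).
Let e : Tor 0 (quotmod A) (quotmod B) := Tor0_unit A B.
Let t : Rc := loc (iota ('X - z%:P)).

Lemma Tor0_unit_cong p q : sigma p = sigma q -> loc p *: e = loc q *: e.
Proof.
move=> pq; apply/eqP; rewrite -subr_eq0 -scalerBl; apply/eqP/Tor0_unit_annr.
have -> : loc p - loc q = loc (p - q).
  by apply/eqP; rewrite subr_eq -to_localD subrK.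
by apply: span_incl; exists (p - q) => //; apply/I_def; rewrite rmorphB pq subrr.
Qed.

Lemma iota_c q : (iota q).@[c] = q.[z].
Proof. by rewrite -sigma_c iotaK. Qed.

(* The factorisation [sigma p = h (X - z)^i] with [h(z) <> 0] lifts modulo [I]. *)
Lemma Tor0_unit_factor p : sigma p != 0 -> exists (u u' : Rc),
  u' * u = 1 /\ loc p *: e = (u * t ^+ mup z (sigma p)) *: e.
Proof.
move=> p0; have [i [h /implyP/(_ p0) hz pE]] := multiplicity_XsubC (sigma p) z.
have -> : mup z (sigma p) = i by rewrite pE mupMr // mup_XsubCX eqxx.
have hc : (iota h).@[c] != 0 by rewrite iota_c.
have [u' u'E] := to_local_unit hc; exists (loc (iota h)), u'; split; first exact: u'E.
rewrite -to_localX -to_localM; apply: Tor0_unit_cong.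
by rewrite rmorphM rmorphXn /= !iotaK.
Qed.

Lemma Tor0_length : is_length (Tor 0 (quotmod A) (quotmod B)) m.
Proof.
apply: (@uniserial_length _ _ e t).
  (* Write [v = r *: e] with [r = p / q]: either [p] is in [I] and [v = 0], or [p] acts on [e] as a
     unit times a power of [t]. *)
  move=> v; have [r ->] := Tor0_unit_gen v; have [p [q [qc rE]]] := local_frac r.
  have [p0|p0] := eqVneq (sigma p) 0; [left|right].
    by apply: Tor0_unit_annr; exact: (span_kernel qc rE p0).
  have [u [u' [uu' pE]]] := Tor0_unit_factor p0; have [w wq] := to_local_unit qc.
  exists (w * u), (u' * loc q), (mup z (sigma p)); split.
    by rewrite mulrACA [loc q * u]mulrC mulrACA uu' mul1r -wq mulrC.
  exact: scale_eq_frac wq rE pE.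
move=> i; split=> [ti0|mi].
  (* Both ideals lie in the submodule cut out by divisibility by [('X - z%:P) ^+ m], so [t ^+ i]
     does too. This power then divides [('X - z%:P) ^+ i] times a polynomial nonzero at [z], whence
     [m <= i]. *)
  have /sigma_dvd_frac : sigma_dvd (('X - z%:P) ^+ m) (t ^+ i).
    apply: Tor0_unit_ann_inv ti0; first exact: sigma_dvd_submodule.
      by apply: sub_divisor_sigma_dvd; rewrite -mup_geq.
    exact: sub_kernel_sigma_dvd.
  move=> /(_ (iota ('X - z%:P) ^+ i) 1)[||q qc].
  - by rewrite meval1 oner_neq0.
  - by rewrite to_local1 mulr1 to_localX.
  rewrite rmorphXn /= iotaK -mup_geq.
    by rewrite mupMl ?mup_XsubCX ?eqxx // rootE sigma_c.
  by rewrite mulf_neq0 ?sigma_neq0 // expf_neq0 ?polyXsubC_eq0.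
(* Conversely, [d] kills [e] and acts on it as a unit times [t ^+ m]. *)
have [u [u' [uu' dE]]] := Tor0_unit_factor sigma_d.
have de0 : loc d *: e = 0.
  by apply/Tor0_unit_annl/span_divisor; exists 1; rewrite mul1r.
have tm0 : t ^+ m *: e = 0 by apply: (scale_unit_eq0 uu'); rewrite -dE.
by rewrite -(subnK mi) exprD -scalerA tm0 scaler0.
Qed.

Lemma intersection_mult_curve_divisor : intersection_mult c D I = Some m%:Z.
Proof.
have len0 : module_length (Tor 0 (local_quot c D) (local_quot c I)) = Some m.
  by apply: is_length_module_length; exact: Tor0_length.
have lenS j : module_length (Tor j.+1 (local_quot c D) (local_quot c I)) = Some 0%N.
  apply: module_length0; apply: (@Tor_principal_eq0 _ _ (loc d)).
  - exact: span_divisor.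
  - move=> a; apply: local_mulI; apply: contra_neq sigma_d => ->; exact: rmorph0.
  - exact: divisor_regular.
exact: (alternating_sum_concentrated (len :=
  fun i => module_length (Tor i (local_quot c D) (local_quot c I))) N len0 lenS).
Qed.

End LocalCurve.

(** * The graph of an operator curve *)

Lemma mmap_horner (k : fieldType) N (h : 'I_N -> {poly k}) z p :
  (mmap polyC h p).[z] = p.@[fun i => (h i).[z]].
Proof.
rewrite [p]mpolyE !raddf_sum /= horner_sum; apply: eq_bigr => mm _.
rewrite mmapZ mevalZ hornerM hornerC mmapX mevalX horner_prod.
by congr (_ * _); apply: eq_bigr => i _; rewrite horner_exp.
Qed.

(** Used with the identity and restriction to the curve, to propagate a congruence from variables to
    monomials. *)
Lemma span_ideal_closed (S : comNzRingType) (X : set S^o)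
    (f g : {rmorphism S -> S}) x y :
  span X (f x - g x) -> span X (f y - g y) -> span X (f (x * y) - g (x * y)).
Proof.
move=> Ix Iy; rewrite !rmorphM.
have -> : f x * f y - g x * g y = f y *: (f x - g x : S^o) + g x *: (f y - g y : S^o).
  by rewrite /GRing.scale /=; ring.
have sX := span_submodule X.
exact: submoduleD sX (submoduleZ _ sX Ix) (submoduleZ _ sX Iy).
Qed.

Lemma span1 (S : comNzRingType) (s : S) (x : S^o) :
  span [set s : S^o] x <-> exists a, x = a * s.
Proof.
split=> [|[a ->]].
  move/(_ (fun x => exists a, x = a * s)); apply.
    split=> [|r _ _ [a ->] [b ->]]; first by exists 0; rewrite mul0r.
    by exists (r * a + b); rewrite mulrDl -mulrA.
  by move=> _ ->; exists 1; rewrite mul1r.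
exact: (submoduleZ a (span_submodule _) (span_incl _)).
Qed.

Section CurveGraph.
Variables (k : fieldType) (n : nat) (L : operator_curve k n).
Local Notation P := {mpoly k[(n * n).+1]}.

(** The parametrisation of the graph, with the parameter in the last slot as in [point_of]. *)
Definition curve_coord (i : 'I_(n * n).+1) : {poly k} :=
  if unlift ord_max i is Some j then mxvec (curve_mx L) 0 j else 'X.

(* Restriction of a polynomial function to the graph of [L]. *)
Definition curve_eval : {rmorphism P -> {poly k}} := mmap polyC curve_coord.

(** Embeds [k[lambda]] as the polynomials in the last variable. *)
Definition param_poly : {rmorphism {poly k} -> P} :=
  horner_eval ('X_ord_max : P) \o map_poly (@mpolyC (n * n).+1 k).

Lemma curve_coord_lift i j :
  curve_coord (fintype.lift ord_max (mxvec_index i j)) = curve_mx L i j.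
Proof. by rewrite /curve_coord liftK mxvecE. Qed.

Lemma curve_mx_horner z i j : (curve_mx L i j).[z] = curve_at L z i j.
Proof.
rewrite /curve_mx /curve_at !summxE horner_sum; apply: eq_bigr => l _.
by rewrite !mxE hornerM hornerXn hornerC.
Qed.

Lemma curve_coord_horner z i : (curve_coord i).[z] = point_of (curve_at L z) z i.
Proof.
rewrite /curve_coord /point_of; case: unlift => [j|]; last exact: hornerX.
by case/mxvec_indexP: j => a b; rewrite !mxvecE curve_mx_horner.
Qed.

Lemma curve_evalX i : curve_eval 'X_i = curve_coord i.
Proof. by rewrite /curve_eval /= mmapX mmap1U. Qed.

Lemma curve_evalC a : curve_eval a%:MP = a%:P.
Proof. exact: mmapC. Qed.

Lemma mwiden_generic i j :
  mwiden (generic_mx k n i j) = 'X_(fintype.lift ord_max (mxvec_index i j)).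
Proof.
rewrite mxE mwidenX mnmwiden1; congr 'X_[U_(_)].
by apply: ord_inj; rewrite lift_max.
Qed.

Lemma param_polyK : cancel param_poly curve_eval.
Proof.
move=> q; rewrite /param_poly /= /horner_eval -horner_map /= curve_evalX.
rewrite -map_poly_comp /curve_coord unlift_none.
rewrite (eq_map_poly (g := polyC)); last exact: curve_evalC.
exact: comp_polyXr.
Qed.

Lemma curve_eval_det : curve_eval (mwiden (\det (generic_mx k n))) = \det (curve_mx L).
Proof.
rewrite -!det_map_mx; congr (\det _); apply/matrixP => i j.
rewrite mxE mxE [X in curve_eval X]mwiden_generic.
by rewrite curve_evalX curve_coord_lift.
Qed.

(** Modulo the ideal each matrix coordinate equals the corresponding entry of [L] at lambda. The
    polynomials satisfying the congruence contain constants and variables and are closed under sums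
    and products. *)
Lemma resolution_ideal_cong p : resolution_ideal L (p - param_poly (curve_eval p)).
Proof.
have res_sub : submodule (resolution_ideal L : set P^o) := span_submodule _.
pose Q (q : P) := resolution_ideal L (q - param_poly (curve_eval q)).
have QM q r : Q q -> Q r -> Q (q * r).
  exact: (@span_ideal_closed P _ idfun (param_poly \o curve_eval)).
have QC a : Q a%:MP.
  rewrite /Q curve_evalC /= /horner_eval map_polyC hornerC subrr.
  exact: res_sub.1.
have Q1 : Q 1 by exact: (QC 1).
have QX i : Q 'X_i.
  rewrite /Q curve_evalX /=; case: (unliftP ord_max i) => [j|] ->.
    case/mxvec_indexP: j => a b; rewrite curve_coord_lift -mwiden_generic.
    by apply: span_incl; exists a, b.
  rewrite /curve_coord unlift_none /= /horner_eval map_polyX hornerX subrr.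
  exact: res_sub.1.
rewrite -/(Q p); elim/mpolyind: p => [|a mm p _ _ Qp]; first exact: (QC 0).
have Qa : Q (a *: 'X_[mm]).
  rewrite -mul_mpolyC; apply: (QM _ _ (QC a)); rewrite mpolyXE_id.
  elim/big_ind: _ => [|q r|i _]; [exact: Q1|exact: QM|].
  elim: (mm i) => [|j Qj]; first exact: Q1.
  by rewrite exprS; apply: QM.
rewrite /Q !rmorphD /= opprD addrACA.
exact: submoduleD res_sub Qa Qp.
Qed.

(** The generators restrict to 0 on the graph; conversely, the congruence puts every polynomial
    vanishing there in the ideal. *)
Lemma resolution_idealP p : resolution_ideal L p <-> curve_eval p = 0.
Proof.
split=> [|p0]; last first.
  by have := resolution_ideal_cong p; rewrite p0 rmorph0 subr0.
move/(_ (fun q => curve_eval q = 0)); apply.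
  split=> [|a u v u0 v0]; first exact: rmorph0.
  by rewrite rmorphD rmorphM u0 v0 mulr0 addr0.
move=> _ [i [j ->]]; rewrite rmorphB mwiden_generic curve_evalX curve_coord_lift.
by rewrite (param_polyK (curve_mx L i j)) subrr.
Qed.

(** Multiplicativity of [mwiden] keeps the extended ideal principal. *)
Lemma proj_preimage_singularP p :
  proj_preimage (singular_ideal k n) p <->
  exists a, p = a * mwiden (\det (generic_mx k n)).
Proof.
split=> [|/span1].
  move=> Ip; apply/span1; apply: Ip; first exact: span_submodule.
  move=> _ [q /span1[a ->] <-]; apply/span1; exists (mwiden a).
  by rewrite mwidenM.
apply=> [|_ ->]; first exact: span_submodule.
apply: span_incl; exists (\det (generic_mx k n)) => //.
exact: span_incl.
Qed.

End CurveGraph.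

Theorem theorem3p1 (k : closedFieldType) (n : nat) (n_ge1 : (1 <= n)%N)
    (L : operator_curve k n) (hL : spectrum L <> [set: k]%classic)
    (z : k) (hz : spectrum L z) :
  Some (alg_mult L z)%:Z%R =
  intersection_mult (point_of (curve_at L z) z)
    (proj_preimage (singular_ideal k n)) (resolution_ideal L).
Proof.
(* Writes [det L] as the restriction to the graph of the generic determinant, the [sigma d] of the
   local computation. *)
rewrite /alg_mult -(curve_eval_det L); apply/esym.
apply: (@intersection_mult_curve_divisor _ _ _ z (curve_eval L) (param_poly k n)).
- by move=> p; rewrite mmap_horner; apply: meval_eq => i; exact: curve_coord_horner.
- exact: param_polyK.
- exact: proj_preimage_singularP.
- exact: resolution_idealP.
(* Were [det L] the zero polynomial, every scalar would be in the spectrum, against [hL]. *)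
rewrite curve_eval_det; apply: contra_notN hL => /eqP detL0.
apply/seteqP; split=> // y _; rewrite /spectrum /=.
have -> : curve_at L y = map_mx (horner_eval y) (curve_mx L).
  by apply/matrixP => i j; rewrite [RHS]mxE /horner_eval curve_mx_horner.
by rewrite det_map_mx detL0 rmorph0.
Qed.
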